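(* Let $\Omega$ be a finite set of size $2n$ and let $G$ be a permutation group on $\Omega$ (that is, $G\leq \mathrm{Sym}(\Omega)$) having exactly two orbits $\Omega_1$ and $\Omega_2$ on $\Omega$, each of length $n$. If $n=pq$ with $p,q$ primes (not necessarily distinct), then $G$ contains a derangement.
   Context: A derangement in a group $G$ acting on a set $\Omega$ is an element of $G$ that fixes no point of $\Omega$. All groups and sets are finite. *)

(* Defs.v *)
From mathcomp Require Import all_boot all_fingroup.

Set Implicit Arguments.
Unset Strict Implicit.
Unset Printing Implicit Defensive.

Definition derangement (aT : finGroupType) (D : {set aT}) (rT : finType)
    (to : action D rT) (a : aT) : bool :=
  [forall x : rT, to x a != x].

Definition orbits (aT : finGroupType) (D : {set aT}) (rT : finType)
    (to : action D rT) (A : {set aT}) : {set {set rT}} :=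
  orbit to A @: [set: rT].

(* Main.v *)
Require Import Defs.
From mathcomp Require Import all_boot all_fingroup.
From mathcomp Require Import all_solvable.

Set Implicit Arguments.
Unset Strict Implicit.
Unset Printing Implicit Defensive.

(** The idea is to let a subgroup of prime power order do the moving: the
    conjugates of two proper subgroups never cover a p-group, because proper
    subgroups lie in normal maximal ones and no group is the union of two
    proper subgroups. So a p-group with two nontrivial orbits contains an
    element moving every point of both ([pgroup_moves_two_orbits]).

    If p = q, a Sylow p-subgroup P of G is still transitive on both orbits,
    whose size p ^ 2 is a power of p, and this already gives the derangement.

    If q < p, every orbit of P inside the given G-orbits has size p, since its
    size is a power of p that is a multiple of p and at most pq < p ^ 2. Hence
    the stabilizers P_y are normal of index p in P, and are Sylow subgroups of
    the stabilizers G_y. An argument of Burnside then shows that N = 'N_G(P)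
    permutes transitively, by conjugation, the set S_i of the stabilizers P_y
    for y in the i-th orbit ([stabilizers_orbit]). The fibres of y |-> P_y have
    the same size, a multiple of p, so #|S_i| divides q and is 1 or q.
    - If some S_i is a singleton, at most 1 + q <= p subgroups of index p
      arise as a P_y, too few to cover P ([small_cover_not_full]): any element
      of P outside all of them fixes no point.
    - Otherwise S_1 and S_2 both have size q, so a Sylow q-subgroup Q of N is
      transitive on each of them, and some z in Q normalizes no P_y, by the
      first paragraph applied to the conjugation action of Q. As z normalizes
      P, fixing y would force it to normalize P_y; so z fixes no point. *)

Section Groups.

Local Open Scope group_scope.

(** * Coverings of a group by subgroups *)

(** Both subgroups may be enlarged to maximal ones, which are normal in a
    p-group and so absorb all conjugates; it remains to avoid two proper
    subgroups. *)
Lemma pgroup_avoid_conjugates (gT : finGroupType) (p : nat)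
    (Q A B : {group gT}) :
    p.-group Q -> A \proper Q -> B \proper Q ->
  exists2 z, z \in Q & {in Q, forall y, (z \notin A :^ y) && (z \notin B :^ y)}.
Proof.
move=> pQ ltAQ ltBQ.
have enlarge (C : {group gT}) : C \proper Q ->
    exists M : {group gT}, [/\ C \subset M, M \proper Q & M <| Q].
  move=> ltCQ; have [eqCQ|[M maxM sCM]] := maximal_exists (proper_sub ltCQ).
    by rewrite eqCQ properxx in ltCQ.
  by exists M; rewrite (maxgroupp maxM) (p_maximal_normal pQ maxM).
have [M [sAM /properP[sMQ [a Qa M'a]] nMQ]] := enlarge A ltAQ.
have [L [sBL /properP[sLQ [b Qb L'b]] nLQ]] := enlarge B ltBQ.
suff [z Qz /andP[M'z L'z]]: exists2 z, z \in Q & (z \notin M) && (z \notin L).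
  exists z => // y Qy; apply/andP; split.
    apply: contra M'z => Az; rewrite -(normP (subsetP (normal_norm nMQ) y Qy)).
    by apply: subsetP Az; rewrite conjSg.
  apply: contra L'z => Bz; rewrite -(normP (subsetP (normal_norm nLQ) y Qy)).
  by apply: subsetP Bz; rewrite conjSg.
have [La | L'a] := boolP (a \in L); last by exists a => //; rewrite M'a.
have [Mb | M'b] := boolP (b \in M); last by exists b => //; rewrite M'b.
exists (a * b); first by rewrite groupM.
by rewrite groupMr // M'a groupMl.
Qed.

(** All members of the cover share the identity, so counting the other elements
    is enough: at most p subgroups of order at most #|P| / p contain at most
    #|P| - p of the #|P| - 1 nontrivial elements of P. *)
Lemma small_cover_not_full (gT : finGroupType) (P : {group gT}) (p : nat)
    (S : {set {group gT}}) :
    1 < p -> #|S| <= p -> {in S, forall H : {group gT}, p * #|H| <= #|P|} ->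
  exists2 z, z \in P & {in S, forall H : {group gT}, z \notin H}.
Proof.
move=> p_gt1 leSp leH.
have [-> | [H0 SH0]] := set_0Vmem S.
  by exists 1 => [|H]; rewrite ?group1 ?inE.
have lePp : p <= #|P|.
  by apply: leq_trans (leH H0 SH0); rewrite leq_pmulr ?cardG_gt0.
suff /subsetPn[z Pz S'z] : ~~ (P^# \subset \bigcup_(H in S) (H : {set gT})^#).
  have [z1 Pz'] := setD1P Pz; exists z => // H SH.
  by apply: contra S'z => Hz; apply/bigcupP; exists H; rewrite ?inE ?z1.
apply: contraL (p_gt1) => /subset_leq_card; rewrite -leqNgt.
have cardD1 (H : {group gT}) : #|H^#| = #|H|.-1.
  by rewrite (cardsD1 1 H) group1.
rewrite cardD1 => leP.
have leU : #|\bigcup_(H in S) (H : {set gT})^#| <= \sum_(H in S) #|H^#|.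
  elim/big_rec2: _ => [|H n U _ leUn]; first by rewrite cards0.
  by rewrite (leq_trans (leq_card_setU _ _)) // leq_add2l.
have : p * \sum_(H in S) #|H^#| <= p * (#|P| - p).
  rewrite big_distrr /=; apply: (@leq_trans (\sum_(H in S) (#|P| - p))).
    by apply: leq_sum => H SH; rewrite cardD1 -subn1 mulnBr muln1 leq_sub2r ?leH.
  by rewrite sum_nat_const leq_mul2r leSp orbT.
rewrite leq_mul2l (gtn_eqF (ltnW p_gt1)) /= => leS.
have := leq_trans leP (leq_trans leU leS).
by rewrite -subn1 leq_sub2lE //.
Qed.

(** * Fusion of normal subgroups of a Sylow subgroup *)

(** Burnside's argument: P and its conjugate by g both normalize K, hence are
    Sylow subgroups of 'N_G(K) and conjugate there; this corrects g to an
    element that normalizes P. *)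
Lemma normal_Sylow_fusion (gT : finGroupType) (p : nat) (G P : {group gT})
    (H K : {group gT}) (g : gT) :
    p.-Sylow(G) P -> H <| P -> K <| P -> g \in G -> H :^ g = K ->
  exists2 h, h \in 'N_G(P) & H :^ h = K.
Proof.
move=> sylP nHP nKP Gg defK.
have sPG := pHall_sub sylP.
pose NK := 'N_G(K)%G.
have sylNK : p.-Sylow(NK) P.
  apply: pHall_subl sylP; last exact: subsetIl.
  by rewrite subsetI sPG normal_norm.
have sylNKg : p.-Sylow(NK) (P :^ g).
  have : p.-Sylow(G) (P :^ g) by rewrite pHallJ.
  apply: pHall_subl; last exact: subsetIl.
  by rewrite subsetI conj_subG //= -defK normJ conjSg normal_norm.
have [k /setIP[Gk nKk] defP] := Sylow_trans sylNKg sylNK.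
exists (g * k); last by rewrite conjsgM defK (normP nKk).
by rewrite inE groupM //=; apply/normP; rewrite conjsgM -defP.
Qed.

End Groups.

Section Action.

Local Open Scope group_scope.

Variables (aT : finGroupType) (rT : finType) (to : {action aT &-> rT}).
Implicit Types (G P Q : {group aT}) (x y : rT).

(** * Orbits and point stabilizers of a Sylow subgroup *)

(** The stabilizers of the points in an orbit of Q form a conjugacy class of
    proper subgroups, and two such classes do not cover Q. *)
Lemma pgroup_moves_two_orbits (p : nat) Q x1 x2 :
    p.-group Q -> 1 < #|orbit to Q x1| -> 1 < #|orbit to Q x2| ->
  exists2 z, z \in Q
    & {in orbit to Q x1 :|: orbit to Q x2, forall y, to y z != y}.
Proof.
move=> pQ; rewrite !card_orbit !indexg_gt1 => nfix1 nfix2.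
have pr x : ~~ (Q \subset 'C_Q[x | to]) -> 'C_Q[x | to] \proper Q.
  by move=> nfix; rewrite properE subsetIl.
have [z Qz avoid] := pgroup_avoid_conjugates pQ (pr _ nfix1) (pr _ nfix2).
exists z => // y xQy; apply: contraTneq isT => /astab1P fix_z.
have stab x a : a \in Q -> to x a = y -> z \in 'C_Q[x | to] :^ a.
  by move=> Qa def_y; rewrite conjIg conjGid // inE Qz -astab1_act def_y.
case/setUP: xQy => /orbitP[a Qa /(stab _ _ Qa) Cz];
  by have:= avoid a Qa; rewrite Cz // andbF.
Qed.

(** The index of P_x in P is the p-part of #|G| / #|P_x|, and #|P_x| divides the
    p-part of #|G_x|. *)
Lemma dvdn_card_orbit_Sylow (p : nat) G P x :
  p.-Sylow(G) P -> #|orbit to G x|`_p %| #|orbit to P x|.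
Proof.
move=> sylP; have pP := pHall_pgroup sylP.
have stab_gt0 : 0 < #|'C_P[x | to]| by apply: cardG_gt0.
rewrite -(dvdn_pmul2r stab_gt0) card_orbit_stab (card_Hall sylP).
rewrite -(card_orbit_stab to G x) partnM ?cardG_gt0 //; last first.
  by rewrite card_gt0; apply/set0Pn; exists x; apply: orbit_refl.
rewrite dvdn_mul // -(part_pnat_id (pgroupS (subsetIl P _) pP)).
by apply: partn_dvd; rewrite ?cardG_gt0 // cardSg // setSI // (pHall_sub sylP).
Qed.

Definition stabilizers P (A : {set rT}) : {set {group aT}} :=
  [set 'C_P[y | to]%G | y in A].

(** The stabilizers of two points in a G-orbit are conjugate in G. As P_x and
    P_y are Sylow subgroups of these, they are conjugate in G too, and as they
    are normal in P, they are conjugate in 'N_G(P) by fusion. *)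
Lemma stabilizers_orbit (p : nat) G P x :
    p.-Sylow(G) P -> {in orbit to G x, forall y, 'C_P[y | to] <| P} ->
    {in orbit to G x, forall y, p.-Sylow('C_G[y | to]) 'C_P[y | to]} ->
  stabilizers P (orbit to G x) = orbit 'JG 'N_G(P) 'C_P[x | to]%G.
Proof.
move=> sylP nP sylPy; have Ox := orbit_refl to G x.
apply/setP=> H; apply/imsetP/orbitP=> [[y xGy ->] | [h /setIP[Gh nPh] <-]].
  have /orbitP[g Gg def_y] := xGy.
  have sylPxg : p.-Sylow('C_G[y | to]) ('C_P[x | to] :^ g).
    by rewrite -def_y astab1_act -{1}(conjGid Gg) -conjIg pHallJ2 sylPy.
  have [c /setIP[Gc yc] defPy] := Sylow_trans sylPxg (sylPy y xGy).
  have [] := @normal_Sylow_fusion _ p G P 'C_P[x | to]%G 'C_P[y | to]%G (g * c).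
  - exact: sylP.
  - exact: nP.
  - exact: nP.
  - exact: groupM.
  - by rewrite conjsgM -defPy.
  by move=> h Nh defPh; exists h => //; apply: group_inj.
exists (to x h); first exact: mem_orbit.
by apply: group_inj; rewrite /= astab1_act conjIg (normP nPh).
Qed.

(** The map y |-> P_y from the orbit to the set of stabilizers commutes with the
    action of 'N_G(P), which is transitive on its image; so all its fibres have
    the same size. That size is a multiple of p because P acts on each fibre
    (P_y being normal in P) without fixed points (P_y being proper). *)
Lemma dvdn_card_stabilizers (p : nat) G P x :
    p.-Sylow(G) P -> {in orbit to G x, forall y, 'C_P[y | to] \proper P} ->
    {in orbit to G x, forall y, 'C_P[y | to] <| P} ->
    stabilizers P (orbit to G x) = orbit 'JG 'N_G(P) 'C_P[x | to]%G ->
  p * #|stabilizers P (orbit to G x)| %| #|orbit to G x|.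
Proof.
set O := orbit to G x => sylP ltP nP defS.
pose f y : {group aT} := 'C_P[y | to]%G.
pose F H := [set y in O | f y == H].
have actO a y : a \in G -> (to y a \in O) = (y \in O).
  by move=> Ga; apply/acts_act/Ga/acts_orbit/subsetT.
have fN y h : h \in 'N_G(P) -> f (to y h) = (f y :^ h)%G.
  case/setIP=> _ nPh; apply: group_inj.
  by rewrite /f /= astab1_act (conjIg P) (normP nPh).
have F_N H h : h \in 'N_G(P) -> #|F H| <= #|F (H :^ h)%G|.
  move=> Nh; rewrite -(card_setact to _ h); apply: subset_leq_card.
  apply/subsetP=> _ /imsetP[y /setIdP[Oy /eqP fy] ->].
  by rewrite inE fN // fy eqxx actO ?Oy //; case/setIP: Nh.
have F_const : {in stabilizers P O, forall H, #|F H| = #|F (f x)|}.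
  rewrite defS => _ /orbitP[h Nh <-]; apply/eqP; rewrite eqn_leq F_N // andbT.
  have := F_N (f x :^ h)%G _ (groupVr Nh).
  by rewrite (_ : (_ :^ _^-1)%G = f x) //; apply: (actK 'JG h).
have dvd_pF : p %| #|F (f x)|.
  have actsF : [acts P, on F (f x) | to].
    apply/actsP=> a Pa y; have Na : a \in 'N_G(P).
      by rewrite inE (subsetP (pHall_sub sylP)) //= (subsetP (normG P)).
    have [Ga _] := setIP Na.
    rewrite inE fN // [RHS]inE actO //; apply: andb_id2l => Oy.
    by congr (_ == _); apply/group_inj/normP/(subsetP (normal_norm (nP y Oy))).
  have := pgroup_fix_mod (pHall_pgroup sylP) actsF.
  rewrite (_ : 'Fix_(_ | _)(P) = set0); first by rewrite cards0 mod0n => /eqP.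
  apply/setP=> y; rewrite in_set0 in_setI [y \in F _]inE -sub_astab1.
  apply/negP=> /andP[/andP[Oy _]].
  by have [_] := andP (ltP y Oy); rewrite subsetI subxx => /negP.
suff -> : #|O| = (#|stabilizers P O| * #|F (f x)|)%N.
  rewrite mulnC dvdn_pmul2l // card_gt0; apply/set0Pn; exists (f x).
  by rewrite imset_f ?orbit_refl.
rewrite -sum1_card (partition_big_imset f) /= -sum_nat_const.
apply: eq_bigr => H SH; rewrite -(F_const H SH) -sum1_card.
by apply: eq_bigl => y; rewrite inE.
Qed.

Lemma orbit_Sylow (p : nat) G P x :
    p.-Sylow(G) P -> p.-nat #|orbit to G x| ->
  orbit to P x = orbit to G x.
Proof.
move=> sylP pO; apply/eqP; rewrite eqEcard imsetS ?(pHall_sub sylP) //=.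
rewrite -{1}(part_pnat_id pO) dvdn_leq ?(dvdn_card_orbit_Sylow _ sylP) //.
by rewrite card_gt0; apply/set0Pn; exists x; apply: orbit_refl.
Qed.

(** * Orbits of size p q with q < p *)

Section LargePrime.

Variables (p q : nat) (G P : {group aT}) (x : rT).
Hypotheses (p_pr : prime p) (q_gt0 : 0 < q) (ltqp : q < p).
Hypotheses (sylP : p.-Sylow(G) P) (oO : #|orbit to G x| = (p * q)%N).

Let part_pq : ((p * q)`_p)%N = p.
Proof.
rewrite (partnM _ (prime_gt0 p_pr) q_gt0) part_pnat_id ?pnat_id //.
by rewrite part_p'nat ?muln1 // p'natE // gtnNdvd.
Qed.

Lemma card_orbit_large_prime : {in orbit to G x, forall y, #|orbit to P y| = p}.
Proof.
move=> y /orbit_eqP defO.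
have : p.-nat #|orbit to P y|.
  by apply: pnat_dvd (dvdn_orbit to P y) (pHall_pgroup sylP).
case/p_natP=> k oPy.
have dvd_p : p %| #|orbit to P y|.
  by have:= dvdn_card_orbit_Sylow y sylP; rewrite defO oO part_pq.
have ltp2 : #|orbit to P y| < p ^ 2.
  apply: leq_ltn_trans (_ : p * q < _); last by rewrite ltn_pmul2l ?prime_gt0.
  by rewrite -oO -defO subset_leq_card // imsetS ?(pHall_sub sylP).
rewrite oPy ltn_exp2l ?prime_gt1 // in ltp2.
move: dvd_p; rewrite oPy; case: k ltp2 {oPy} => [|[|k]] //.
by rewrite dvdn1 gtn_eqF ?prime_gt1.
Qed.

Lemma stab_index y : y \in orbit to G x -> (p * #|'C_P[y | to]|)%N = #|P|.
Proof.
by move=> Oy; rewrite -(card_orbit_stab to P y) card_orbit_large_prime.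
Qed.

Lemma stab_normal y : y \in orbit to G x -> 'C_P[y | to] <| P.
Proof.
move=> Oy; apply: (p_maximal_normal (pHall_pgroup sylP)).
apply: p_index_maximal; first exact: subsetIl.
by rewrite -card_orbit card_orbit_large_prime.
Qed.

Lemma stab_Sylow y : y \in orbit to G x -> p.-Sylow('C_G[y | to]) 'C_P[y | to].
Proof.
move=> Oy; rewrite pHallE setSI ?(pHall_sub sylP) //=.
rewrite -(eqn_pmul2l (prime_gt0 p_pr)) stab_index // (card_Hall sylP).
have pq_gt0 : 0 < (p * q)%N by rewrite muln_gt0 prime_gt0.
rewrite -(card_orbit_stab to G y) (orbit_eqP Oy) oO.
by rewrite (partnM _ pq_gt0) ?cardG_gt0 ?part_pq.
Qed.

Lemma stabilizers_orbit_large_prime :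
  stabilizers P (orbit to G x) = orbit 'JG 'N_G(P) 'C_P[x | to]%G.
Proof. exact: stabilizers_orbit sylP stab_normal stab_Sylow. Qed.

Lemma dvdn_card_stabilizers_large_prime :
  #|stabilizers P (orbit to G x)| %| q.
Proof.
have p_gt0 := prime_gt0 p_pr.
rewrite -(dvdn_pmul2l p_gt0) -oO.
apply: dvdn_card_stabilizers sylP _ stab_normal stabilizers_orbit_large_prime.
move=> y Oy; rewrite properEcard subsetIl -(stab_index Oy) /=.
by rewrite ltn_Pmull ?prime_gt1 ?cardG_gt0.
Qed.

End LargePrime.

End Action.

(** * Derangements on two orbits of size p q *)

Section TwoOrbits.

Local Open Scope group_scope.

Variables (aT : finGroupType) (rT : finType) (to : {action aT &-> rT}).
Implicit Types (G : {group aT}) (x : rT).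

Lemma two_orbits_ltn_primes (p q : nat) G x1 x2 :
    prime p -> prime q -> q < p ->
    #|orbit to G x1| = (p * q)%N -> #|orbit to G x2| = (p * q)%N ->
  exists2 z, z \in G
    & {in orbit to G x1 :|: orbit to G x2, forall y, to y z != y}.
Proof.
move=> p_pr q_pr ltqp oO1 oO2; have [P sylP] := Sylow_exists p G.
have q_gt0 := prime_gt0 q_pr; have sPG := pHall_sub sylP.
set O1 := orbit to G x1; set O2 := orbit to G x2.
have S_in y : y \in O1 :|: O2 ->
    'C_P[y | to]%G \in stabilizers to P O1 :|: stabilizers to P O2.
  by case/setUP=> Oy; apply/setUP; [left | right]; apply: imset_f.
have dvdS x : #|orbit to G x| = (p * q)%N ->
    #|stabilizers to P (orbit to G x)| %| q.
  by apply: dvdn_card_stabilizers_large_prime.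
(* Too few stabilizers to cover P: a derangement is found inside P. *)
have [leSp | ltpS] := leqP #|stabilizers to P O1 :|: stabilizers to P O2| p.
  have [|z Pz avoid] := @small_cover_not_full _ P _ _ (prime_gt1 p_pr) leSp.
    move=> _ /setUP[] /imsetP[y Oy ->];
      by rewrite (stab_index p_pr q_gt0 ltqp sylP _ Oy).
  exists z => [|y Oy]; first exact: subsetP Pz.
  apply: contra (avoid _ (S_in y Oy)) => /eqP fix_z.
  by rewrite inE Pz; apply/astab1P.
have [oS1 oS2] : #|stabilizers to P O1| = q /\ #|stabilizers to P O2| = q.
  (* A singleton would leave at most 1 + q <= p stabilizers in all. *)
  have ltp_sum := leq_trans ltpS (leq_card_setU _ _).
  have [_ dvd_q] := primeP q_pr.
  have /pred2P[oS1 | oS1] := dvd_q _ (dvdS _ oO1);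
    have /pred2P[oS2 | oS2] := dvd_q _ (dvdS _ oO2) => //;
    move: ltp_sum; rewrite /O1 /O2 oS1 oS2 ?add1n ?addn1 ltnS leqNgt.
  - by rewrite prime_gt1.
  - by rewrite ltqp.
  by rewrite ltqp.
(* Two sets of size q, on which a Sylow q-subgroup of 'N_G(P) is transitive. *)
have [Q sylQ] := Sylow_exists q 'N_G(P).
have orbQ x : #|orbit to G x| = (p * q)%N ->
    #|stabilizers to P (orbit to G x)| = q ->
    orbit 'JG Q 'C_P[x | to]%G = stabilizers to P (orbit to G x).
  move=> oO oS.
  rewrite (stabilizers_orbit_large_prime p_pr q_gt0 ltqp sylP oO) in oS *.
  by apply: orbit_Sylow sylQ _; rewrite oS pnat_id.
have [||z Qz moves] :=
    @pgroup_moves_two_orbits _ _ 'JG q Q 'C_P[x1 | to]%G 'C_P[x2 | to]%G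
      (pHall_pgroup sylQ).
- by rewrite orbQ // oS1 prime_gt1.
- by rewrite orbQ // oS2 prime_gt1.
have /setIP[Gz nPz] := subsetP (pHall_sub sylQ) z Qz.
exists z => // y /S_in; rewrite -(orbQ _ oO1 oS1) -(orbQ _ oO2 oS2) => /moves.
apply: contra => /eqP fix_z; apply/eqP/group_inj.
by rewrite /= conjIg (normP nPz) -astab1_act fix_z.
Qed.

Lemma two_orbits_prime_square (p : nat) G x1 x2 :
    prime p -> #|orbit to G x1| = (p * p)%N -> #|orbit to G x2| = (p * p)%N ->
  exists2 z, z \in G
    & {in orbit to G x1 :|: orbit to G x2, forall y, to y z != y}.
Proof.
move=> p_pr oO1 oO2; have [P sylP] := Sylow_exists p G.
have p2_gt1 : 1 < (p * p)%N by rewrite -(exp1n 2) ltn_exp2r ?prime_gt1.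
have orbP x : #|orbit to G x| = (p * p)%N -> orbit to P x = orbit to G x.
  by move=> oO; apply: orbit_Sylow sylP _; rewrite oO pnatM pnat_id.
have [||z Pz moves] :=
    @pgroup_moves_two_orbits _ _ to p P x1 x2 (pHall_pgroup sylP).
- by rewrite orbP ?oO1.
- by rewrite orbP ?oO2.
exists z => [|y]; first exact: subsetP (pHall_sub sylP) z Pz.
by rewrite -(orbP _ oO1) -(orbP _ oO2); apply: moves.
Qed.

End TwoOrbits.

Theorem corollary3p5 (Omega : finType) (G : {group {perm Omega}})
    (Omega1 Omega2 : {set Omega}) (n p q : nat)
    (card_Omega : #|Omega| = 2 * n)
    (orbits_G : orbits 'P G = [set Omega1; Omega2])
    (neq_Omega12 : Omega1 != Omega2)
    (card_Omega1 : #|Omega1| = n) (card_Omega2 : #|Omega2| = n)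
    (prime_p : prime p) (prime_q : prime q) (def_n : n = p * q) :
  exists2 g : {perm Omega}, g \in G & derangement 'P g.
Proof.
have /imsetP[x1 _ defO1] : Omega1 \in orbits 'P G by rewrite orbits_G set21.
have /imsetP[x2 _ defO2] : Omega2 \in orbits 'P G by rewrite orbits_G set22.
rewrite def_n defO1 in card_Omega1; rewrite def_n defO2 in card_Omega2.
have [g Gg moves] : exists2 g, g \in G
    & {in orbit 'P G x1 :|: orbit 'P G x2, forall y, 'P%act y g != y}.
  have [ltpq | ltqp | eqpq] := ltngtP p q.
  - by apply: (two_orbits_ltn_primes prime_q prime_p ltpq); rewrite mulnC.
  - exact: (two_orbits_ltn_primes prime_p prime_q ltqp).
  by apply: (two_orbits_prime_square prime_p); rewrite {2}eqpq.
exists g => //; apply/forallP=> y; apply: moves.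
have : orbit 'P G y \in orbits 'P G by apply: imset_f.
by rewrite orbits_G defO1 defO2 !inE => /orP[] /eqP <-; rewrite orbit_refl ?orbT.
Qed.
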